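(* Let $\varepsilon>0$ be given (sufficiently small), let $f:2^{N}\to\mathbb{R}_{\ge 0}$ be a normalized monotone submodular function accessible via a value oracle, with $|N|=n$, and let $k\in\mathbb{N}$. There is a randomized algorithm (randomized-parallel-greedy) which with high probability computes a set $Q\subseteq N$ with $|Q|\le k$ and $f(Q)\ge(1-\varepsilon)(1-e^{-1})\max_{|S|\le k}f(S)$, using $O\!\left(\frac{\log n}{\varepsilon^2}\right)$ expected adaptivity and $\tilde O\!\left(\frac{n}{\varepsilon^4}\right)$ expected oracle calls to $f$.
   Context: A set function $f$ is submodular if $f(A)+f(B)\ge f(A\cup B)+f(A\cap B)$ for all $A,B\subseteq N$, monotone if $S\subseteq T\Rightarrow f(S)\le f(T)$, normalized if $f(\emptyset)=0$. Adaptivity is the number of rounds of queries, where each query in a round depends only on answers from previous rounds. $\tilde O$ suppresses polylogarithmic factors. ''With high probability'' means with probability at least $1-1/\mathrm{poly}(n)$. *)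

(* Defs.v *)
From mathcomp Require Import all_boot all_order all_algebra.
From mathcomp Require Import interval_inference reals.

Set Implicit Arguments.
Unset Strict Implicit.
Unset Printing Implicit Defensive.

Import Order.TTheory GRing.Theory Num.Theory.
Local Open Scope ring_scope.

Section SetFunctions.
Variables (R : realType) (N : finType).
Implicit Type f : {set N} -> R.

Definition submodular f : Prop :=
  forall A B : {set N}, f (A :|: B) + f (A :&: B) <= f A + f B.

Definition monotone f : Prop :=
  forall S T : {set N}, S \subset T -> f S <= f T.

Definition normalized f : Prop := f set0 = 0.

(* The base value of the iterated maximum is the value of an admissible set,
   so it contributes nothing to the maximum. *)
Definition max_card_le f (k : nat) : R :=
  \big[Num.max/f set0]_(S : {set N} | (#|S| <= k)%N) f S.

End SetFunctions.

(* Randomized algorithms with access to a value oracle on the subsets of [N],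
   as well-founded decision trees.  [Toss p t] flips an independent coin that
   comes up [true] with probability [p].  [Query qs t] is one adaptive round:
   all of [qs] is submitted at once, before any answer of the round is known,
   and the list of answers is passed to [t].  The function under the oracle is
   not an argument: answers to queries are the only way to learn about it. *)
Inductive oracle_alg (R : realType) (N : finType) (A : Type) : Type :=
| Return of A
| Toss of {i01 R} & (bool -> oracle_alg R N A)
| Query of seq {set N} & (seq R -> oracle_alg R N A).

Section Semantics.
Variables (R : realType) (N : finType) (A : Type).

(* [expect f t g] is the expectation, over the coins of [t] run with oracle
   [f], of [g a r q], where [a] is the output, [r] the number of rounds and
   [q] the total number of oracle calls (with multiplicity) of the run. *)
Fixpoint expect (f : {set N} -> R) (t : oracle_alg R N A)
    (g : A -> nat -> nat -> R) : R :=
  match t with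
  | Return a => g a 0%N 0%N
  | Toss p t' =>
      p%:num * expect f (t' true) g + (1 - p%:num) * expect f (t' false) g
  | Query qs t' =>
      expect f (t' (map f qs)) (fun a r q => g a r.+1 (size qs + q)%N)
  end.

Definition output_prob f (t : oracle_alg R N A) (P : pred A) : R :=
  expect f t (fun a _ _ => (P a)%:R).

Definition expected_adaptivity f (t : oracle_alg R N A) : R :=
  expect f t (fun _ r _ => r%:R).

Definition expected_oracle_calls f (t : oracle_alg R N A) : R :=
  expect f t (fun _ _ q => q%:R).

End Semantics.

(* Main.v *)
Require Import Defs.
From mathcomp Require Import all_boot all_order all_algebra.
From mathcomp Require Import interval_inference reals sequences exp convex.
From mathcomp Require Import ring lra.

(* With [e = eps / 2], fix a guess [v] of the optimum and lower a threshold
   [tau] geometrically from [v / k] to about [v / (exp 1 * k)], in [O(1 / e)]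
   phases.  A step at a solution [S] draws a random sequence from the set of
   elements of marginal gain at least [tau], and adds its longest prefix whose
   gain, which is queried, is at least [(1 - e) * tau] per draw.  So the quality
   of what is added is certain, and only the progress is random: with
   probability at least [1 / 2] a step either fills the solution up to [k]
   elements or removes a fraction [e / 6] of the elements above the threshold,
   whence [O(log n / e)] steps exhaust a phase with high probability.  As in the
   greedy algorithm, when all phases are exhausted
   [OPT - f S <= OPT * exp (- (1 - e)^2 * #|S| / k)], and either [#|S| = k] or
   every marginal gain is so small that [OPT - f S <= OPT / exp 1].  A geometric
   grid of [O(log n / e)] guesses is run in parallel, and the best outcome is
   returned. *)

Set Implicit Arguments.
Unset Strict Implicit.
Unset Printing Implicit Defensive.

Import Order.TTheory GRing.Theory Num.Theory.
Local Open Scope ring_scope.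

(** * Oracle algorithms *)

Section Combinators.
Variables (R : realType) (N : finType).
Local Notation alg := (oracle_alg R N).

Fixpoint bind (A B : Type) (t : alg A) (k : A -> alg B) : alg B :=
  match t with
  | Return a => k a
  | Toss p t' => Toss p (fun b => bind (t' b) k)
  | Query qs t' => Query qs (fun ans => bind (t' ans) k)
  end.

(* Runs two algorithms side by side, merging their [i]-th rounds. *)
Fixpoint par (A B : Type) (t1 : alg A) : alg B -> alg (A * B) :=
  match t1 with
  | Return a => fun t2 => bind t2 (fun b => Return R N (a, b))
  | Toss p k1 => fun t2 => Toss p (fun c => par (k1 c) t2)
  | Query qs1 k1 =>
      fix par2 (t2 : alg B) : alg (A * B) :=
        match t2 with
        | Return b => Query qs1 (fun ans => par (k1 ans) (Return R N b))
        | Toss p k2 => Toss p (fun c => par2 (k2 c))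
        | Query qs2 k2 =>
            Query (qs1 ++ qs2) (fun ans =>
              par (k1 (take (size qs1) ans)) (k2 (drop (size qs1) ans)))
        end
  end.

Fixpoint par_map (T A : Type) (t : T -> alg A) (s : seq T) : alg (seq A) :=
  match s with
  | [::] => Return R N [::]
  | x :: s' =>
      bind (par (t x) (par_map t s')) (fun p => Return R N (p.1 :: p.2))
  end.

(** * Expectation, certainty and cost of a run against a fixed oracle *)

Section Oracle.
Variable f : {set N} -> R.

Definition mean A (t : alg A) (h : A -> R) : R := expect f t (fun a _ _ => h a).

Fixpoint surely A (t : alg A) (P : A -> Prop) : Prop :=
  match t with
  | Return a => P a
  | Toss _ t' => surely (t' true) P /\ surely (t' false) P
  | Query qs t' => surely (t' (map f qs)) P
  end.

(** A budget for every coin branch rather than on average: such budgets add up under [bind]. *)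
Fixpoint cost_le A (t : alg A) (r q : nat) : Prop :=
  match t with
  | Return _ => True
  | Toss _ t' => cost_le (t' true) r q /\ cost_le (t' false) r q
  | Query qs t' =>
      [/\ (0 < r)%N, (size qs <= q)%N &
          cost_le (t' (map f qs)) r.-1 (q - size qs)]
  end.

Lemma eq_expect A (t : alg A) (g h : A -> nat -> nat -> R) :
  (forall a r q, g a r q = h a r q) -> expect f t g = expect f t h.
Proof.
elim: t g h => [a|p t IH|qs t IH] /= g h gh; [exact: gh| |exact: IH].
by rewrite !(IH _ _ _ gh).
Qed.

Lemma surely_mono A (t : alg A) (P Q : A -> Prop) :
  (forall a, P a -> Q a) -> surely t P -> surely t Q.
Proof.
move=> PQ; elim: t => [a|p t IH|qs t IH] /=; [exact: PQ| |exact: IH].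
by case=> /IH ? /IH.
Qed.

Lemma surelyT A (t : alg A) (P : A -> Prop) : (forall a, P a) -> surely t P.
Proof.
by move=> HP; elim: t => [a|p t IH|qs t IH] //=; split; apply: IH.
Qed.

Lemma surelyI A (t : alg A) (P Q : A -> Prop) :
  surely t P -> surely t Q -> surely t (fun a => P a /\ Q a).
Proof.
elim: t => [a|p t IH|qs t IH] //=; last exact: IH.
by move=> [P1 P2] [Q1 Q2]; split; apply: IH.
Qed.

Lemma surely_bind A B (t : alg A) (k : A -> alg B) (P : B -> Prop) :
  surely t (fun a => surely (k a) P) -> surely (bind t k) P.
Proof.
elim: t => [a|p t IH|qs t IH] //=; last exact: IH.
by move=> [/IH ? /IH].
Qed.

Lemma le_mean A (t : alg A) (g h : A -> R) :
  surely t (fun a => g a <= h a) -> mean t g <= mean t h.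
Proof.
rewrite /mean; elim: t => [a|p t IH|qs t IH] //=; last exact: IH.
move=> [/IH H1 /IH H2]; by apply: lerD; apply: ler_wpM2l.
Qed.

Lemma eq_mean A (t : alg A) (g h : A -> R) :
  surely t (fun a => g a = h a) -> mean t g = mean t h.
Proof.
by move=> H; apply/eqP; rewrite eq_le !le_mean //;
  apply: surely_mono H => a ->.
Qed.

Lemma mean_Toss A p (t : bool -> alg A) (h : A -> R) :
  mean (Toss p t) h =
  p%:num * mean (t true) h + (1 - p%:num) * mean (t false) h.
Proof. by []. Qed.

Lemma mean_Query A qs (t : seq R -> alg A) (h : A -> R) :
  mean (Query qs t) h = mean (t (map f qs)) h.
Proof. by []. Qed.

Lemma mean_cst A (t : alg A) (c : R) : mean t (fun=> c) = c.
Proof.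
rewrite /mean; elim: t => [a|p t IH|qs t IH] //=.
by rewrite !IH -mulrDl addrC subrK mul1r.
Qed.

Lemma meanD A (t : alg A) (g h : A -> R) :
  mean t (fun a => g a + h a) = mean t g + mean t h.
Proof.
rewrite /mean; elim: t => [a|p t IH|qs t IH] //=.
by rewrite !IH; ring.
Qed.

Lemma meanZ A (t : alg A) (c : R) (h : A -> R) :
  mean t (fun a => c * h a) = c * mean t h.
Proof.
rewrite /mean; elim: t => [a|p t IH|qs t IH] //=.
by rewrite !IH; ring.
Qed.

Lemma mean_bind A B (t : alg A) (k : A -> alg B) (h : B -> R) :
  mean (bind t k) h = mean t (fun a => mean (k a) h).
Proof. by rewrite /mean; elim: t => [a|p t IH|qs t IH] //=; rewrite !IH. Qed.

Lemma output_prob_ge A (t : alg A) (P : pred A) (c : R) (h : A -> R) :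
  surely t (fun a => 1 - h a <= (P a)%:R) -> mean t h <= c ->
  1 - c <= output_prob f t P.
Proof.
move=> /le_mean; rewrite [X in X <= _ -> _]meanD mean_cst.
rewrite (_ : mean t (fun a => - h a) = - mean t h); last first.
  rewrite -mulN1r -meanZ; apply: eq_mean; apply: surelyT => a.
  by rewrite mulN1r.
by move=> H Hc; apply: le_trans H; rewrite lerD2l lerN2.
Qed.

Lemma cost_le_mono A (t : alg A) r q r' q' : (r <= r')%N -> (q <= q')%N ->
  cost_le t r q -> cost_le t r' q'.
Proof.
elim: t r q r' q' => [a|p t IH|qs t IH] //= r q r' q' rr qq.
  by case=> H1 H2; split; exact: IH rr qq _.
case=> r0 qsq H; split; [exact: leq_trans rr|exact: leq_trans qq|].
by apply: IH H; [rewrite -!subn1 leq_sub2r|rewrite leq_sub2r].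
Qed.

Lemma cost_le_bind A B (t : alg A) (k : A -> alg B) r1 q1 r2 q2 :
  cost_le t r1 q1 -> surely t (fun a => cost_le (k a) r2 q2) ->
  cost_le (bind t k) (r1 + r2) (q1 + q2).
Proof.
elim: t r1 q1 => [a|p t IH|qs t IH] /= r1 q1.
- by move=> _; apply: cost_le_mono; rewrite leq_addl.
- by move=> [? ?] [? ?]; split; apply: IH.
- move=> [r0 qq H] K; split; [exact: ltn_addr|exact: leq_trans (leq_addr _ _)|].
  by rewrite -addnBAC // -{1}(prednK r0) addSn /=; apply: IH.
Qed.

Lemma expect_cost A (t : alg A) r q : cost_le t r q ->
  expected_adaptivity f t <= r%:R /\ expected_oracle_calls f t <= q%:R.
Proof.
rewrite /expected_adaptivity /expected_oracle_calls.
(* The offsets [r0] and [q0] make the induction go through: each [Query] shifts the counts seen by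
   its continuation. *)
suff H r0 q0 : cost_le t r q ->
    expect f t (fun _ i _ => (r0 + i)%:R) <= (r0 + r)%:R /\
    expect f t (fun _ _ j => (q0 + j)%:R) <= (q0 + q)%:R by exact: (H 0 0)%N.
elim: t r q r0 q0 => [a|p t IH|qs t IH] /= r q r0 q0.
- by move=> _; rewrite !addn0 !ler_nat !leq_addr.
- move=> [/(IH _ _ _ r0 q0)[A1 A2] /(IH _ _ _ r0 q0)[B1 B2]].
  have conv (x y z : R) : x <= z -> y <= z ->
      p%:num * x + (1 - p%:num) * y <= z.
    move=> xz yz; rewrite -[leRHS](_ : p%:num * z + (1 - p%:num) * z = z).
      by apply: lerD; apply: ler_wpM2l.
    by ring.
  by split; apply: conv.
- move=> [r_gt0 qq /(IH _ _ _ r0.+1 (q0 + size qs)%N)[H1 H2]]; split.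
    rewrite -(prednK r_gt0) -addSnnS; apply: le_trans H1.
    by rewrite (eq_expect _ (fun _ i _ => congr1 _ (addSnnS r0 i))).
  rewrite -(subnKC qq) addnA; apply: le_trans H2.
  by rewrite (eq_expect _ (fun _ _ j => congr1 _ (addnA q0 _ j))).
Qed.

End Oracle.
End Combinators.

(** * Side-by-side runs: marginal laws and costs *)

Section ParallelComposition.
Variables (R : realType) (N : finType) (f : {set N} -> R).
Local Notation alg := (oracle_alg R N).

Lemma surely_par A B (t1 : alg A) (t2 : alg B) (P : A -> Prop) (Q : B -> Prop) :
  surely f t1 P -> surely f t2 Q ->
  surely f (par t1 t2) (fun p => P p.1 /\ Q p.2).
Proof.
elim: t1 t2 => [a|p t IH|qs t IH] /= t2.
- by move=> Pa Qt; apply: surely_bind; apply: surely_mono Qt.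
- by move=> [P1 P2] Qt; split; apply: IH.
- move=> Pt; elim: t2 => [b|p t2 IH2|qs2 t2 IH2] /=.
  + by move=> Qb; apply: IH.
  + by move=> [Q1 Q2]; split; apply: IH2.
  + move=> Qt; rewrite map_cat take_size_cat ?drop_size_cat ?size_map //.
    exact: IH.
Qed.

Lemma cost_le_par A B (t1 : alg A) (t2 : alg B) r q1 q2 :
  cost_le f t1 r q1 -> cost_le f t2 r q2 ->
  cost_le f (par t1 t2) r (q1 + q2).
Proof.
elim: t1 t2 r q1 q2 => [a|p t IH|qs t IH] /= t2 r q1 q2.
- move=> _ H; rewrite -(addn0 r) -[X in cost_le _ _ _ X]addn0.
  apply: cost_le_bind; last exact: surelyT.
  by apply: cost_le_mono H => //; rewrite leq_addl.
- by move=> [P1 P2] Qt; split; apply: IH.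
- move=> [r0 s1 Pt]; elim: t2 q2 => [b|p t2 IH2|qs2 t2 IH2] q2 /=.
  + move=> _; split => //; first exact: leq_trans (leq_addr _ _).
    by rewrite -addnBAC //; apply: IH.
  + by move=> [Q1 Q2]; split; apply: IH2.
  + move=> [_ s2 Qt]; rewrite size_cat; split; [by []|exact: leq_add|].
    rewrite map_cat take_size_cat ?drop_size_cat ?size_map //.
    rewrite subnDA -addnBAC // -addnBA //.
    exact: IH.
Qed.

(** The two sides toss separate coins and a merged round splits its answers again, so each side
    keeps the law it has when run alone. *)
Lemma mean_par_fst A B (t1 : alg A) (t2 : alg B) (h : A -> R) :
  mean f (par t1 t2) (fun p => h p.1) = mean f t1 h.
Proof.
elim: t1 t2 => [a|p t IH|qs t IH] /= t2.
- by rewrite mean_bind; exact: (mean_cst f t2 (h a)).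
- by rewrite !mean_Toss !IH.
- elim: t2 => [b|p t2 IH2|qs2 t2 IH2] /=.
  + exact: IH.
  + rewrite !mean_Toss !IH2.
    by rewrite -mulrDl addrC subrK mul1r.
  + by rewrite mean_Query map_cat take_size_cat ?drop_size_cat ?size_map.
Qed.

Lemma mean_par_snd A B (t1 : alg A) (t2 : alg B) (h : B -> R) :
  mean f (par t1 t2) (fun p => h p.2) = mean f t2 h.
Proof.
elim: t1 t2 => [a|p t IH|qs t IH] /= t2.
- by rewrite mean_bind.
- rewrite !mean_Toss !IH.
  by rewrite -mulrDl addrC subrK mul1r.
- elim: t2 => [b|p t2 IH2|qs2 t2 IH2] /=.
  + exact: IH.
  + by rewrite !mean_Toss !IH2.
  + by rewrite mean_Query map_cat take_size_cat ?drop_size_cat ?size_map // IH.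
Qed.

Lemma surely_par_map T A (t : T -> alg A) (s : seq T) (P : A -> Prop) :
  (forall x, surely f (t x) P) ->
  surely f (par_map t s)
    (fun l => size l = size s /\ forall d i, (i < size s)%N -> P (nth d l i)).
Proof.
move=> Pt; elim: s => [|x s IH] //=; apply: surely_bind.
apply: surely_mono (surely_par (Pt x) IH) => -[a l] /= [Pa [-> Pl]].
by split=> // d [|i] //=; apply: Pl.
Qed.

Lemma cost_le_par_map T A (t : T -> alg A) (s : seq T) r q :
  (forall x, cost_le f (t x) r q) ->
  cost_le f (par_map t s) r (size s * q).
Proof.
move=> Ct; elim: s => [|x s IH] //=.
rewrite mulSn -(addn0 r) -[X in cost_le _ _ _ X]addn0.
by apply: cost_le_bind; [apply: cost_le_par|apply: surelyT].
Qed.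

(** The run at [x] keeps its law inside the composition, and its success already makes [has P]
    true. *)
Lemma output_prob_par_map (T : eqType) A (t : T -> alg A) (s : seq T) x
    (P : pred A) :
  x \in s -> output_prob f (t x) P <= output_prob f (par_map t s) (has P).
Proof.
rewrite /output_prob -!/(mean f _ _).
elim: s => //= y s IH; rewrite inE mean_bind => /predU1P[->|/IH {}IH].
  rewrite -(mean_par_fst (t y) (par_map t s)); apply: le_mean.
  by apply: surelyT => -[a l] /=; rewrite /mean /=; case: (P a); rewrite ?ler0n.
apply: le_trans IH _; rewrite -(mean_par_snd (t y) (par_map t s)).
apply: le_mean; apply: surelyT => -[a l] /=; rewrite /mean /=.
by case: (P a); rewrite ?lexx //; case: (has P l); rewrite ?ler01.
Qed.

End ParallelComposition.

(** * Uniform sampling from biased coins *)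

Section Sampling.
Variables (R : realType) (N : finType).
Local Notation alg := (oracle_alg R N).

Lemma invS_le1 (n : nat) : n.+1%:R^-1 <= 1 :> R.
Proof. by rewrite invf_le1 ?ltr0n // ler1n. Qed.

Lemma invS_ge0 (n : nat) : 0 <= n.+1%:R^-1 :> R.
Proof. by rewrite invr_ge0 ler0n. Qed.

(** Keeping the head of a list of length [m] with probability [1 / m], and otherwise recursing on
    the tail, is uniform. *)
Fixpoint pick (T : Type) (x : T) (s : seq T) : alg T :=
  if s is y :: s' then
    Toss (Itv01 (invS_ge0 (size s)) (invS_le1 (size s)))
      (fun b => if b then Return R N x else pick y s')
  else Return R N x.

(** Draws are with replacement: each is uniform on the same list whatever came before, on which the
    induction over the remaining draws relies. *)
Fixpoint draws (T : Type) (x : T) (s : seq T) (m : nat) : alg (seq T) :=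
  if m is m'.+1 then
    bind (pick x s) (fun a =>
    bind (draws x s m') (fun w => Return R N (a :: w)))
  else Return R N [::].

Definition sample (T : Type) (s : seq T) (m : nat) : alg (seq T) :=
  if s is x :: s' then draws x s' m else Return R N [::].

Variable f : {set N} -> R.

Lemma surely_pick (T : eqType) (x : T) (s : seq T) :
  surely f (pick x s) (fun y => y \in x :: s).
Proof.
elim: s x => [|y s IH] x; rewrite /= ?mem_head //; split => //.
apply: surely_mono (IH y) => z.
by rewrite [z \in [:: x, _ & _]]in_cons => ->; rewrite orbT.
Qed.

Lemma mean_pick (T : Type) (x : T) (s : seq T) (h : T -> R) :
  mean f (pick x s) h = (\sum_(y <- x :: s) h y) / (size s).+1%:R.
Proof.
elim: s x => [|y s IH] x; first by rewrite big_seq1 divr1.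
rewrite mean_Toss IH !big_cons {1}/mean /=.
have -> : (size s).+2%:R = (size s).+1%:R + 1 :> R by rewrite -natr1.
have := ltr0Sn R (size s); move: (_.+1%:R) (\sum_(_ <- _) _) => a b a0.
by field; rewrite !gt_eqF //; lra.
Qed.

Lemma mean_sampleS (T : eqType) (s : seq T) (m : nat) (h : seq T -> R) :
  s != [::] -> mean f (sample s m.+1) h =
  (\sum_(x <- s) mean f (sample s m) (fun w => h (x :: w))) / (size s)%:R.
Proof.
case: s => //= x s _; rewrite mean_bind mean_pick; congr (_ / _).
by apply: eq_bigr => y _; rewrite mean_bind.
Qed.

Lemma surely_sample (T : eqType) (s : seq T) (m : nat) : s != [::] ->
  surely f (sample s m) (fun w => size w = m /\ {subset w <= s}).
Proof.
case: s => //= x s _; elim: m => [|m IH] //=; apply: surely_bind.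
apply: surely_mono (surely_pick x s) => y ys; apply: surely_bind.
apply: surely_mono IH => w [<- ws]; split=> // z.
by rewrite inE => /predU1P[->|/ws].
Qed.

Lemma cost_le_sample (T : eqType) (s : seq T) (m : nat) :
  cost_le f (sample s m) 0 0.
Proof.
case: s => //= x s; elim: m => [|m IH] //=.
apply: (@cost_le_bind _ _ _ _ _ _ _ 0 0 0 0).
  by elim: s x {IH} => [|y s IH] x //=.
apply: surelyT => a; apply: (@cost_le_bind _ _ _ _ _ _ _ 0 0 0 0) => //.
exact: surelyT.
Qed.

End Sampling.

(** * A step at a fixed threshold *)

Section Gains.
Variables (R : realType) (N : finType) (f : {set N} -> R).
Hypotheses (f_mono : monotone f) (f_sub : submodular f).
Implicit Types (S T U : {set N}) (x : N) (tau : R).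

Definition gain S x : R := f (x |: S) - f S.

Definition live tau S : {set N} := [set x | tau <= gain S x].

Lemma gain_ge0 S x : 0 <= gain S x.
Proof. by rewrite subr_ge0; apply: f_mono; apply: subsetUr. Qed.

Lemma gain_anti S T x : S \subset T -> gain T x <= gain S x.
Proof.
move=> ST; have := f_sub (x |: S) T; rewrite -setUA (setUidPr ST).
have : f S <= f ((x |: S) :&: T).
  by apply: f_mono; rewrite subsetI ST subsetUr.
by rewrite /gain; lra.
Qed.

Lemma gain_union S T : f (S :|: T) - f S <= \sum_(x in T) gain S x.
Proof.
rewrite -big_enum -{1}(set_enum T) /=; elim: (enum T) => [|x s IH].
  by rewrite big_nil set_nil setU0 subrr.
rewrite set_cons big_cons setUCA.
have : gain (S :|: [set:: s]) x <= gain S x.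
  by apply: gain_anti; apply: subsetUl.
by move: IH; rewrite /gain; lra.
Qed.

Lemma live_anti tau S T : S \subset T -> live tau T \subset live tau S.
Proof.
move=> ST; apply/subsetP => x; rewrite !inE => /le_trans; apply.
exact: gain_anti.
Qed.

Lemma live_notin tau S x : 0 < tau -> x \in live tau S -> x \notin S.
Proof.
move=> tau0; rewrite inE /gain; apply: contraTN => xS.
by rewrite (setUidPr _) ?sub1set // subrr -ltNge.
Qed.

Lemma card_live_setU1 tau S x : 0 < tau -> x \in live tau S ->
  (#|live tau (x |: S)| < #|live tau S|)%N.
Proof.
move=> tau0 xl; apply: proper_card; apply/properP; split.
  by apply: live_anti; apply: subsetUr.
by exists x => //; apply: contraTN (setU11 x S) => /(live_notin tau0).
Qed.

Lemma le_max_card k S : (#|S| <= k)%N -> f S <= max_card_le f k.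
Proof. exact: le_bigmax_cond. Qed.

Lemma max_card_attained k :
  exists2 S : {set N}, (#|S| <= k)%N & max_card_le f k = f S.
Proof.
have H0 : (#|@set0 N| <= k)%N by rewrite cards0.
rewrite /max_card_le; have [|S Sk ->] :=
    @eq_bigmax _ _ {set N} (f set0) set0
      (fun S : {set N} => (#|S| <= k)%N) f H0.
  by move=> S _; apply: f_mono; apply: sub0set.
by exists S.
Qed.

Lemma max_card_le_gain k S tau : 0 <= tau -> (forall x, gain S x <= tau) ->
  max_card_le f k - f S <= k%:R * tau.
Proof.
move=> tau0 Htau; have [T Tk ->] := max_card_attained k.
have H1 : f T <= f (S :|: T) by apply: f_mono; apply: subsetUr.
have H2 := gain_union S T.
have H3 : \sum_(x in T) gain S x <= k%:R * tau.
  apply: (@le_trans _ _ (\sum_(x in T) tau)); first exact: ler_sum.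
  rewrite sumr_const -[leLHS]mulr_natl; apply: ler_wpM2r => //.
  by rewrite ler_nat.
by lra.
Qed.

End Gains.

(** * One step: sampling and the longest good prefix *)

Section Step.
Variables (R : realType) (N : finType) (k : nat) (theta tau : R).
Implicit Types (S : {set N}) (w : seq N) (i : nat).

Definition add_take S w i : {set N} := S :|: [set:: take i w].

(** The test bears on the average gain over a prefix, so a few bad draws are tolerated. The values
    are a parameter [v] because the algorithm sees answers and the analysis sees [f]. *)
Definition best_prefix S w (v : nat -> R) : nat :=
  \max_(i < (size w).+1 |
    (#|add_take S w i| <= k)%N && (theta * i%:R <= v i - v 0%N)) i.

(** The first round finds the live elements, the second values all prefixes at once. There are as
    many draws as live elements, so that running out of draws before exhaustion takes many bad
    ones. *)
Definition step S : oracle_alg R N {set N} :=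
  Query (S :: [seq x |: S | x <- enum N]) (fun ans =>
    let A := [seq p.1 | p <- zip (enum N) (behead ans) &
                        tau <= p.2 - head 0 ans] in
    bind (sample R N A (size A)) (fun w =>
    Query [seq add_take S w i | i <- iota 0 (size w).+1] (fun ans' =>
    Return R N (add_take S w (best_prefix S w (nth 0 ans')))))).

Variable f : {set N} -> R.

Definition next_sol S w : {set N} :=
  add_take S w (best_prefix S w (fun i => f (add_take S w i))).

Lemma step_live S (ans := map f (S :: [seq x |: S | x <- enum N])) :
  [seq p.1 | p <- zip (enum N) (behead ans) & tau <= p.2 - head 0 ans] =
  enum (live f tau S).
Proof.
rewrite /ans /= -map_comp -{1}[enum N]map_id zip_map filter_map.
rewrite -map_comp map_id.
by rewrite enumT; apply: eq_filter => x; rewrite /= inE.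
Qed.

Lemma next_sol_answers S w
    (ans := map f [seq add_take S w i | i <- iota 0 (size w).+1]) :
  add_take S w (best_prefix S w (nth 0 ans)) = next_sol S w.
Proof.
congr add_take; apply: eq_bigl => i; have E j : (j < (size w).+1)%N ->
    nth 0 ans j = f (add_take S w j).
  by move=> jw; rewrite /ans -map_comp (nth_map 0%N) ?size_iota // nth_iota.
by rewrite !E.
Qed.

Lemma mean_step S (h : {set N} -> R) :
  mean f (step S) h =
  mean f (sample R N (enum (live f tau S)) #|live f tau S|) (h \o next_sol S).
Proof.
rewrite mean_Query step_live mean_bind -cardE; apply: eq_mean.
by apply: surelyT => w; rewrite mean_Query next_sol_answers.
Qed.

Lemma surely_step S (P : {set N} -> Prop) :
  surely f (sample R N (enum (live f tau S)) #|live f tau S|)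
    (fun w => P (next_sol S w)) ->
  surely f (step S) P.
Proof.
move=> H; rewrite [surely _ _ _]/(surely f (bind _ _) P) step_live -cardE.
apply: surely_bind; apply: surely_mono H => w.
by rewrite -next_sol_answers.
Qed.

Lemma cost_le_step S : cost_le f (step S) 2 (2 * #|N|.+1).
Proof.
split => //.
  by rewrite /= size_map -cardE mul2n -addnn leq_addr.
rewrite step_live [X in (_ - X)%N]/= size_map -cardE mul2n -addnn addnK.
rewrite -(add0n 1%N) -(add0n #|N|.+1); apply: cost_le_bind.
  exact: cost_le_sample.
case: (eqVneq (enum (live f tau S)) [::]) => [->|ne] /=.
  by split.
apply: surely_mono (surely_sample _ _ ne) => w [Hw _] /=; split => //.
by rewrite size_map size_iota Hw -cardE ltnS max_card.
Qed.

Lemma best_prefixP S w (v : nat -> R) : (#|S| <= k)%N ->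
  let i := best_prefix S w v in
  [/\ (i <= size w)%N, (#|add_take S w i| <= k)%N &
      theta * i%:R <= v i - v 0%N].
Proof.
move=> Sk /=; pose P := [pred i : 'I_(size w).+1 |
  (#|add_take S w i| <= k)%N && (theta * i%:R <= v i - v 0%N)].
(* The empty prefix always qualifies, so the maximum is attained at a qualifying index. *)
have P0 : P ord0.
  by rewrite /= /add_take take0 set_nil setU0 Sk mulr0 subrr lexx.
have [|i Pi Ei] := @eq_bigmax_cond _ P (@nat_of_ord _).
  by apply/card_gt0P; exists ord0.
have -> : best_prefix S w v = i by rewrite -Ei; apply: eq_bigl.
by move: Pi => /andP[-> ->]; split=> //; rewrite -ltnS.
Qed.

(** Since [i] draws add at most [i] elements, a gain of [theta] per draw is one of at least [theta]
    per new element. *)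
Lemma next_sol_spec S w : (#|S| <= k)%N -> 0 <= theta ->
  [/\ S \subset next_sol S w, (#|next_sol S w| <= k)%N &
      theta * #|next_sol S w|%:R <= theta * #|S|%:R + (f (next_sol S w) - f S)].
Proof.
move=> Sk th0; rewrite /next_sol.
have := best_prefixP w (fun i => f (add_take S w i)) Sk.
set i := best_prefix _ _ _ => /= -[iw ik fi]; split => //.
  exact: subsetUl.
have : (#|add_take S w i| <= #|S| + i)%N.
  apply: leq_trans (leq_card_setU _ _) _; rewrite leq_add2l cardsE.
  by apply: leq_trans (card_size _) _; rewrite size_takel.
rewrite -(ler_nat R) natrD => /(ler_wpM2l th0); rewrite mulrDr.
move: fi; rewrite /add_take take0 set_nil setU0; lra.
Qed.

(** The longest qualifying prefix contains every other, so progress only needs some good prefix to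
    exist. *)
Lemma sub_next_sol S w i : (i <= size w)%N -> (#|add_take S w i| <= k)%N ->
  theta * i%:R <= f (add_take S w i) - f S ->
  add_take S w i \subset next_sol S w.
Proof.
move=> iw ik fi; apply: setUS; apply/subsetP => x; rewrite !inE => xi.
set j := best_prefix _ _ _.
have ij : (i <= j)%N.
  rewrite -[i]/(nat_of_ord (Ordinal (iw : i < (size w).+1)%N)).
  apply: leq_bigmax_cond; rewrite /= ik.
  by rewrite {2}/add_take take0 set_nil setU0.
by move: xi; rewrite -(take_takel w ij) => /mem_take.
Qed.

End Step.

(** * Progress of a step *)

Lemma expR_half_le2 (R : realType) : expR 2^-1 <= 2 :> R.
Proof.
have := expR_ge1Dx (- 2^-1 : R); rewrite expRN.
have := expR_gt0 (2^-1 : R); move: (expR _) => y y0 H.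
by rewrite -(invrK y) invf_ple ?posrE ?invr_gt0 //; lra.
Qed.

Section Progress.
Variables (R : realType) (N : finType) (f : {set N} -> R).
Hypotheses (f_mono : monotone f) (f_sub : submodular f).
Variables (k : nat) (e tau : R).
Hypotheses (e_gt0 : 0 < e) (e_le : e <= 2^-1) (tau_gt0 : 0 < tau).
Implicit Types (S T U : {set N}) (x : N) (w : seq N).

Local Notation theta := ((1 - e) * tau).
Local Notation live := (live f tau).

(** It vanishes at [k] elements so that a full solution and an empty live set both count as the end
    of a phase. *)
Definition potential S : nat := if (#|S| < k)%N then #|live S| else 0%N.

Definition exhausted S U : bool :=
  (k <= #|U|)%N || (#|live U|%:R <= (1 - e / 6) * #|live S|%:R).

Definition admissible S U (i : nat) : bool :=
  [&& (#|U| <= k)%N, theta * i%:R <= f U - f S & exhausted S U].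

(** Reads the draws one by one, for an induction on those still to be made; [i] counts the draws,
    repetitions included, that led from [S] to [U]. *)
Fixpoint reaches S U (i : nat) w : bool :=
  admissible S U i ||
  if w is x :: w' then reaches S (x |: U) i.+1 w' else false.

Lemma reachesP S U i w : reaches S U i w ->
  exists2 j, (j <= size w)%N & admissible S (add_take U w j) (i + j).
Proof.
elim: w U i => [|x w IH] U i /=.
  by rewrite orbF => H; exists 0%N; rewrite // /add_take set_nil setU0 addn0.
case/orP => [H|/IH[j jw H]].
  by exists 0%N; rewrite // /add_take take0 set_nil setU0 addn0.
exists j.+1 => //; move: H; rewrite addSnnS /add_take /= set_cons.
by rewrite setUCA setUA.
Qed.

(* The probability that the draws still to be made reach no admissible prefix,
   after [i] draws of which [b] had a gain below [tau], is at most this. *)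
Definition failure_bound (i b : nat) : R := 4 ^+ b / (1 + e / 2) ^+ i / 2.

Lemma failure_bound_gt0 i b : 0 < failure_bound i b.
Proof.
have e0 := e_gt0; rewrite /failure_bound !divr_gt0 ?exprn_gt0 //; lra.
Qed.

Lemma failure_boundS i b :
  failure_bound i b = (1 + e / 2) * failure_bound i.+1 b.
Proof.
have e0 := e_gt0; rewrite /failure_bound exprS; field.
by rewrite expf_neq0 ?gt_eqF //; lra.
Qed.

(** Here [(1 + e / 2) ^+ i] is at most [expR (b / 2)], hence at most [2 ^+ b]; the other factor
    [2 ^+ b] of [4 ^+ b] pays for the final halving, as [b] is positive. *)
Lemma failure_bound_ge1 i b : e * i%:R < b%:R -> 1 <= failure_bound i b.
Proof.
have e0 := e_gt0; move=> eib; have b_gt0 : (0 < b)%N.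
  by rewrite -(ltr_nat R); apply: le_lt_trans eib; rewrite mulr_ge0 // ltW.
rewrite /failure_bound ler_pdivlMr // mul1r ler_pdivlMr ?exprn_gt0 //; last lra.
have pow2 : (1 + e / 2) ^+ i <= 2 ^+ b.
  apply: (@le_trans _ _ (expR (i%:R * (e / 2)))).
    rewrite expRM_natl; apply: lerXn2r; rewrite ?nnegrE ?expR_ge0 //; first lra.
    exact: expR_ge1Dx.
  apply: (@le_trans _ _ (expR (b%:R * 2^-1))); first by rewrite ler_expR; lra.
  rewrite expRM_natl; apply: lerXn2r; rewrite ?nnegrE ?expR_ge0 //.
  exact: expR_half_le2.
have : (2 : R) * 2 ^+ b <= 2 ^+ b * 2 ^+ b.
  apply: ler_wpM2r; first exact: exprn_ge0.
  case: b b_gt0 {eib pow2} => // b _.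
  by rewrite exprS ler_peMr // exprn_ege1 //; lra.
rewrite -exprMn (_ : 2 * 2 = 4 :> R); last by ring.
apply: le_trans; apply: ler_wpM2l => //.
Qed.

Lemma mean_not_reaches_bad S U i b (t : oracle_alg R N (seq N)) :
  e * i%:R < b%:R ->
  mean f t (fun w => (~~ reaches S U i w)%:R) <= failure_bound i b.
Proof.
move=> /failure_bound_ge1; apply: le_trans.
rewrite -[leRHS](mean_cst f t 1); apply: le_mean; apply: surelyT => w.
by case: reaches; rewrite ?ler01.
Qed.

(** If more than [e * i] draws were bad, the bound is trivial. Otherwise the good draws, worth [tau]
    each, average at least [(1 - e) * tau] over all draws, and the current prefix is admissible. *)
Lemma mean_not_reaches_exhausted S U i b (t : oracle_alg R N (seq N)) :
  (#|U| <= k)%N -> tau * (i%:R - b%:R) <= f U - f S -> exhausted S U ->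
  mean f t (fun w => (~~ reaches S U i w)%:R) <= failure_bound i b.
Proof.
move=> Uk fU exh; have [|eib] := ltP (e * i%:R) b%:R.
  exact: mean_not_reaches_bad.
have adm : admissible S U i.
  rewrite /admissible Uk exh andbT; apply: le_trans fU.
  rewrite (mulrC (1 - e)) -mulrA; apply: ler_wpM2l; [exact: ltW|lra].
apply: le_trans (ltW (failure_bound_gt0 _ _)).
rewrite -[leRHS](mean_cst f t 0); apply: le_mean.
by apply: surelyT => -[|x w] /=; rewrite adm.
Qed.

(* [failure_bound] is a supermartingale up to the exhaustion time: before it a
   draw is bad with probability below [e / 6], and a bad draw multiplies the
   bound by [4], so the mean factor [1 + 3 * (e / 6)] cancels the decay. *)
Lemma mean_not_reaches S L U i b : (0 < #|live S|)%N ->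
  S \subset U -> (#|U| <= k)%N -> tau * (i%:R - b%:R) <= f U - f S ->
  (i + #|live U| <= #|live S| + b)%N -> (i + L = #|live S|)%N ->
  mean f (sample R N (enum (live S)) L) (fun w => (~~ reaches S U i w)%:R) <=
  failure_bound i b.
Proof.
have [[e0 e1] t0] := (e_gt0, e_le, tau_gt0); move=> m_gt0.
elim: L U i b => [|L IH] U i b SU Uk fU lU iL.
  have [exh|] := boolP (exhausted S U).
    exact: mean_not_reaches_exhausted.
  rewrite negb_or -ltnNge -ltNge => /andP[Uk' lU'].
  (* No draw is left. Each good draw removed a live element, so [b] is at least [#|live U|], which
     exceeds [(1 - e / 6) * i] and thus [e * i]. *)
  apply: mean_not_reaches_bad; move: lU iL; rewrite addn0 => + iL.
  rewrite iL leq_add2l -(ler_nat R) => H; apply: lt_le_trans H.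
  by apply: le_lt_trans lU'; apply: ler_wpM2r => //; lra.
have [exh|nexh] := boolP (exhausted S U).
  exact: mean_not_reaches_exhausted.
have /andP[Uk' lU'] : (#|U| < k)%N &&
    ((1 - e / 6) * #|live S|%:R < #|live U|%:R).
  by move: nexh; rewrite negb_or -ltnNge -ltNge.
have ne : enum (live S) != [::].
  by rewrite -size_eq0 -cardE -lt0n.
rewrite mean_sampleS // -cardE ler_pdivrMr ?ltr0n //.
set H := failure_bound i.+1 b.
have term x : x \in live S ->
    mean f (sample R N (enum (live S)) L)
      (fun w => (~~ reaches S U i (x :: w))%:R) <=
    H + 3 * H * (x \notin live U)%:R.
  move=> xS.
  have -> : mean f (sample R N (enum (live S)) L)
      (fun w => (~~ reaches S U i (x :: w))%:R) =
      mean f (sample R N (enum (live S)) L)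
      (fun w => (~~ reaches S (x |: U) i.+1 w)%:R).
    apply: eq_mean; apply: surelyT => w /=.
    by rewrite /admissible (negbTE nexh) !andbF.
  have SxU : S \subset x |: U by apply: subset_trans SU _; apply: subsetUr.
  have xUk : (#|x |: U| <= k)%N.
    by apply: leq_trans (leq_card_setU _ _) _; rewrite cards1.
  have iL' : (i.+1 + L = #|live S|)%N by rewrite addSnnS.
  have fx := gain_ge0 f_mono U x.
  have [xU|xU] /= := boolP (x \in live U).
    rewrite mulr0 addr0; apply: IH => //.
      move: xU; rewrite inE; move: fU; rewrite /gain -natr1; lra.
    rewrite addSnnS; apply: leq_trans lU; rewrite leq_add2l.
    exact: card_live_setU1.
  rewrite mulr1 (_ : H + 3 * H = failure_bound i.+1 b.+1); last first.
    by rewrite /H /failure_bound (exprS _ b); ring.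
  apply: IH => //.
    by move: fx fU; rewrite /gain -!natr1; lra.
  rewrite addSn addnS ltnS; apply: leq_trans lU; rewrite leq_add2l.
  by apply: subset_leq_card; apply: live_anti => //; apply: subsetUr.
apply: (@le_trans _ _ (\sum_(x <- enum (live S))
    (H + 3 * H * (x \notin live U)%:R))).
  by rewrite !big_enum /=; apply: ler_sum.
rewrite big_enum big_split /= sumr_const -mulr_sumr.
have -> : \sum_(x in live S) (x \notin live U)%:R =
    #|live S|%:R - #|live U|%:R :> R.
  have lUS := live_anti f_mono f_sub tau SU.
  rewrite -natrB ?subset_leq_card // -(setIidPr lUS) -cardsD.
  rewrite -sum1_card natr_sum big_mkcond [RHS]big_mkcond.
  apply: eq_bigr => x _; rewrite !inE.
  by case: (_ <= _); case: (_ <= _).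
have H0 : 0 <= H := ltW (failure_bound_gt0 _ _).
rewrite failure_boundS -/H -[H *+ _]mulr_natl.
have : 3 * H * (#|live S|%:R - #|live U|%:R) <= 3 * H * (e / 6 * #|live S|%:R).
  apply: ler_wpM2l; first by rewrite mulr_ge0.
  move: lU'; rewrite mulrBl mul1r.
  by move: (#|live S|%:R) (#|live U|%:R) => *; lra.
move: (#|live S|%:R) (#|live U|%:R) => m l; lra.
Qed.

Lemma potential_le S : (potential S <= #|live S|)%N.
Proof. by rewrite /potential; case: ifP. Qed.

Lemma potential_anti S T : S \subset T -> (potential T <= potential S)%N.
Proof.
move=> ST; rewrite /potential; have := subset_leq_card ST.
case: (ltnP #|T| k) => // Tk /leq_ltn_trans /(_ Tk) ->.
by apply: subset_leq_card; apply: live_anti.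
Qed.

Lemma theta_ge0 : 0 <= theta.
Proof. by have [e0 e1] := (e_gt0, e_le); rewrite mulr_ge0 ?ltW //; lra. Qed.

(** As [failure_bound 0 0] is [1 / 2], a step removes at least the fraction [e / 6] of the potential
    at least half of the time and never increases it, hence [e / 12] in the mean. *)
Lemma mean_potential_step S : (#|S| <= k)%N ->
  mean f (step k theta tau S) (fun T => (potential T)%:R) <=
  (1 - e / 12) * (potential S)%:R.
Proof.
have [e0 e1] := (e_gt0, e_le).
rewrite leq_eqVlt => /orP[/eqP Sk|Sk].
  rewrite (_ : potential S = 0%N) ?mulr0; last by rewrite /potential Sk ltnn.
  rewrite -[leRHS](mean_cst f (step k theta tau S) 0); apply: le_mean.
  apply: surely_step; apply: surelyT => w; rewrite (_ : potential _ = 0%N) //.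
  apply/eqP; rewrite -leqn0; apply: (@leq_trans (potential S)).
    by apply: potential_anti; case: (next_sol_spec f w (eq_leq Sk) theta_ge0).
  by rewrite /potential Sk ltnn.
rewrite {2}/potential Sk; have [m0|m_gt0] := posnP #|live S|.
  rewrite m0 mulr0 -[leRHS](mean_cst f (step k theta tau S) 0); apply: le_mean.
  apply: surely_step; apply: surelyT => w; rewrite (_ : potential _ = 0%N) //.
  apply/eqP; rewrite -leqn0 -m0; apply: leq_trans (potential_le _).
  by apply: potential_anti; case: (next_sol_spec f w (ltnW Sk) theta_ge0).
rewrite mean_step; set A := enum _; set m : R := #|live S|%:R.
have m0 : 0 <= m by rewrite ler0n.
apply: (@le_trans _ _ (mean f (sample R N A #|live S|) (fun w =>
    (1 - e / 6) * m + (e / 6 * m) * (~~ reaches S S 0 w)%:R))).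
  apply: le_mean; apply: surelyT => w /=.
  have [Sn nk _] := next_sol_spec f w (ltnW Sk) theta_ge0.
  have [/reachesP[j jw]|_] /= := boolP (reaches _ _ _ _); last first.
    rewrite mulr1 [leRHS](_ : _ = m); last by ring.
    rewrite ler_nat; apply: leq_trans (potential_le _) _.
    by apply: subset_leq_card; apply: live_anti.
  rewrite add0n mulr0 addr0 => /and3P[jk fj exh].
  have sub := sub_next_sol jw jk fj; case/orP: exh => [kj|].
    rewrite /potential ltnNge (leq_trans kj (subset_leq_card sub)) /=.
    by rewrite mulr_ge0 //; lra.
  apply: le_trans; rewrite ler_nat; apply: leq_trans (potential_le _) _.
  by apply: subset_leq_card; apply: live_anti.
rewrite meanD mean_cst meanZ.
have := @mean_not_reaches S #|live S| S 0 0 m_gt0 (subxx _) (ltnW Sk).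
rewrite !subrr mulr0 addn0 !add0n => /(_ (lexx _) (leqnn _) erefl).
rewrite /failure_bound !expr0 divr1 => H.
have : e / 6 * m * mean f (sample R N A #|live S|)
    (fun w => (~~ reaches S S 0 w)%:R) <= e / 6 * m * (1 / 2).
  by apply: ler_wpM2l => //; rewrite mulr_ge0 //; lra.
lra.
Qed.

(** The first draw is a new element that gains [tau] on its own, so the prefix of length one
    qualifies. *)
Lemma step_grows S : (0 < potential S)%N ->
  surely f (step k theta tau S) (fun T : {set N} => (#|S| < #|T|)%N).
Proof.
have [[e0 e1] t0] := (e_gt0, e_le, tau_gt0).
rewrite /potential; case: ifP => // Sk m_gt0; apply: surely_step.
have ne : enum (live S) != [::] by rewrite -size_eq0 -cardE -lt0n.
apply: surely_mono (surely_sample f #|live S| ne) => w [].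
case: w => [|x w] sw; first by rewrite -sw in m_gt0.
move=> /(_ x (mem_head _ _)); rewrite mem_enum => xS.
have E : add_take S (x :: w) 1 = x |: S.
  by rewrite /add_take /= take0 set_cons set_nil setU0 setUC.
have xnS := live_notin tau_gt0 xS.
apply: (@leq_trans #|x |: S|); first by rewrite cardsU1 xnS.
rewrite -E; apply: subset_leq_card; apply: sub_next_sol => //.
  by rewrite E cardsU1 xnS.
move: xS; rewrite E inE /gain mulr1 mulrBl mul1r => xS.
have := mulr_ge0 (ltW e0) (ltW t0); lra.
Qed.

End Progress.

(** * Descending thresholds *)

Section ThresholdGreedy.
Variables (R : realType) (N : finType) (k : nat) (e : R) (r : nat).
Implicit Types (S T : {set N}) (tau : R) (J : nat).

(** The number of steps is fixed in advance, with no test for exhaustion, which keeps the cost bound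
    free of chance. *)
Fixpoint phase tau r S : oracle_alg R N {set N} :=
  if r is r'.+1 then bind (step k ((1 - e) * tau) tau S) (phase tau r')
  else Return R N S.

Fixpoint threshold_greedy tau J S : oracle_alg R N {set N} :=
  if J is J'.+1 then
    bind (phase tau r S) (threshold_greedy ((1 - e) * tau) J')
  else Return R N S.

Variable f : {set N} -> R.
Hypotheses (f_mono : monotone f) (f_sub : submodular f).
Hypotheses (e_gt0 : 0 < e) (e_le : e <= 2^-1).

Lemma cost_le_phase tau s S :
  cost_le f (phase tau s S) (s * 2) (s * (2 * #|N|.+1)).
Proof.
elim: s S => // s IH S; rewrite !mulSn.
apply: cost_le_bind; last exact: surelyT.
exact: cost_le_step.
Qed.

Lemma cost_le_threshold_greedy tau J S :
  cost_le f (threshold_greedy tau J S)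
    (J * (r * 2)) (J * (r * (2 * #|N|.+1))).
Proof.
elim: J tau S => // J IH tau S; rewrite !mulSn; apply: cost_le_bind.
  exact: cost_le_phase.
exact: surelyT.
Qed.

Lemma threshold_ge0 tau : 0 <= tau -> 0 <= (1 - e) * tau.
Proof. by have [e0 e1] := (e_gt0, e_le) => tau0; rewrite mulr_ge0 //; lra. Qed.

Lemma threshold_gt0 tau : 0 < tau -> 0 < (1 - e) * tau.
Proof. by have [e0 e1] := (e_gt0, e_le) => tau0; rewrite mulr_gt0 //; lra. Qed.

Lemma surely_step_subset tau S : 0 <= tau -> (#|S| <= k)%N ->
  surely f (step k ((1 - e) * tau) tau S)
    (fun T : {set N} => S \subset T /\ (#|T| <= k)%N).
Proof.
move=> tau0 Sk; apply: surely_step; apply: surelyT => w.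
by have [] := next_sol_spec f w Sk (threshold_ge0 tau0).
Qed.

Lemma surely_phase tau s S : 0 <= tau -> (#|S| <= k)%N ->
  surely f (phase tau s S) (fun T : {set N} => S \subset T /\ (#|T| <= k)%N).
Proof.
move=> tau0; elim: s S => // s IH S Sk; apply: surely_bind.
apply: surely_mono (surely_step_subset tau0 Sk) => T [ST /IH].
apply: surely_mono => T' [TT' T'k]; split=> //.
exact: subset_trans TT'.
Qed.

Lemma surely_threshold_greedy tau J S : 0 <= tau -> (#|S| <= k)%N ->
  surely f (threshold_greedy tau J S) (fun T : {set N} => (#|T| <= k)%N).
Proof.
elim: J tau S => // J IH tau S tau0 Sk; apply: surely_bind.
apply: surely_mono (surely_phase r tau0 Sk) => T [_ Tk].
by apply: IH => //; apply: threshold_ge0.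
Qed.

Lemma mean_potential_phase tau s S : 0 < tau -> (#|S| <= k)%N ->
  mean f (phase tau s S) (fun T => (potential f k tau T)%:R) <=
  (1 - e / 12) ^+ s * (potential f k tau S)%:R.
Proof.
have [e0 e1] := (e_gt0, e_le) => tau0; elim: s S => [|s IH] S Sk.
  by rewrite expr0 mul1r.
rewrite mean_bind; set q := 1 - e / 12.
apply: (@le_trans _ _ (mean f (step k ((1 - e) * tau) tau S)
    (fun T => q ^+ s * (potential f k tau T)%:R))).
  apply: le_mean; apply: surely_mono (surely_step_subset (ltW tau0) Sk) => T.
  by case=> _ /IH.
rewrite meanZ exprSr -mulrA; apply: ler_wpM2l.
  by apply: exprn_ge0; rewrite /q; lra.
exact: mean_potential_step.
Qed.

Lemma phase_grows tau s S : 0 < tau -> (#|S| <= k)%N ->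
  surely f (phase tau s S) (fun T : {set N} =>
    potential f k tau T = 0%N \/ (#|S| + s <= #|T|)%N).
Proof.
move=> tau0; elim: s S => [|s IH] S Sk; first by right; rewrite addn0.
have sub := surely_step_subset (ltW tau0) Sk.
apply: surely_bind; have [p0|p_gt0] := posnP (potential f k tau S).
  apply: surely_mono sub => T [ST Tk].
  apply: surely_mono (surely_phase s (ltW tau0) Tk) => T' [TT' _]; left.
  apply/eqP; rewrite -leqn0 -p0; apply: potential_anti => //.
  exact: subset_trans TT'.
have grows := step_grows e_gt0 e_le tau0 p_gt0.
apply: surely_mono (surelyI sub grows) => T [[_ /IH H] ST].
apply: surely_mono H => T' [|TT']; [by left|right].
by rewrite addnS; apply: leq_trans TT'; rewrite -addSn leq_add2r.
Qed.

(* Each step of a phase that is not yet over enlarges the solution, so a phase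
   of more than [#|N|] steps never fails. *)
Definition phase_failure : R :=
  if (r <= #|N|)%N then #|N|%:R * (1 - e / 12) ^+ r else 0.

Lemma phase_failure_bound tau S : 0 < tau -> (#|S| <= k)%N ->
  mean f (phase tau r S) (fun T => (0 < potential f k tau T)%N%:R) <=
  phase_failure.
Proof.
have [e0 e1] := (e_gt0, e_le) => tau0 Sk; rewrite /phase_failure.
case: leqP => rn; last first.
  rewrite -[leRHS](mean_cst f (phase tau r S) 0); apply: le_mean.
  apply: surely_mono (phase_grows r tau0 Sk) => T [-> //|].
  move=> /(leq_trans (leq_addl _ _)) /(leq_trans rn).
  by rewrite ltnNge max_card.
(* Markov's inequality: a nonzero potential is at least [1]. *)
apply: (@le_trans _ _ ((1 - e / 12) ^+ r * (potential f k tau S)%:R)).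
  apply: le_trans (mean_potential_phase r tau0 Sk); apply: le_mean.
  by apply: surelyT => T; rewrite ler_nat; case: potential.
rewrite mulrC; apply: ler_wpM2r; first by apply: exprn_ge0; lra.
by rewrite ler_nat; apply: leq_trans (potential_le _ _ _ _) (max_card _).
Qed.

Local Notation OPT := (max_card_le f k).

(** The loop invariant. The gap decays as for greedy, except that one factor [1 - e] is lost on the
    accepted gain per draw, and another because the last clause lets [tau] be as low as
    [(1 - e) * (OPT - f S) / k]. *)
Definition on_track tau S : bool :=
  [&& (#|S| <= k)%N,
      OPT - f S <= OPT * expR (- ((1 - e) ^+ 2 * #|S|%:R / k%:R)) &
      (k <= #|S|)%N || ((1 - e) * (OPT - f S) <= k%:R * tau)].

(** With [l] new elements the value grows by at least [(1 - e) * tau * l]. Below [k] elements [tau]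
    is at least [(1 - e) * (OPT - f S) / k], so the gap shrinks by the factor [1 - a * l / k], at
    most [expR (- (a * l / k))], where [a] is [(1 - e) ^+ 2]. *)
Lemma on_track_step tau S : 0 < tau -> on_track tau S ->
  surely f (step k ((1 - e) * tau) tau S) (on_track tau).
Proof.
have [e0 e1] := (e_gt0, e_le) => tau0 /and3P[Sk fS small].
apply: surely_step; apply: surelyT => w.
have [] := next_sol_spec f w Sk (threshold_ge0 (ltW tau0)).
move: (next_sol _ _ _ _ _) => T ST Tk gainT; rewrite /on_track Tk /=.
have ST' := subset_leq_card ST.
have [kS|Sk'] := leqP k #|S|.
  rewrite (leq_trans kS ST') andbT.
  by have /eqP <- : S == T by rewrite eqEcard ST (leq_trans Tk).
have {}small : (1 - e) * (OPT - f S) <= k%:R * tau.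
  by move: small; rewrite leqNgt Sk'.
have fST := f_mono ST.
have smallT : (1 - e) * (OPT - f T) <= k%:R * tau.
  by apply: le_trans small; apply: ler_wpM2l; lra.
rewrite smallT orbT andbT.
have k0 : 0 < k%:R :> R by rewrite ltr0n; case: k Sk'.
set l : R := #|T|%:R - #|S|%:R.
have l0 : 0 <= l by rewrite subr_ge0 ler_nat.
have D0 : 0 <= OPT - f S by rewrite subr_ge0; apply: le_max_card.
set a : R := (1 - e) ^+ 2.
apply: (@le_trans _ _ ((OPT - f S) * expR (- (a * l / k%:R)))).
  apply: (@le_trans _ _ ((OPT - f S) * (1 - a * l / k%:R))); last first.
    by apply: ler_wpM2l => //; apply: expR_ge1Dx.
  have H1 : (1 - e) * tau * l <= f T - f S by rewrite /l; lra.
  have H2 : (1 - e) * l * ((1 - e) * (OPT - f S)) <= (1 - e) * l * (k%:R * tau).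
    by apply: ler_wpM2l => //; rewrite mulr_ge0 //; lra.
  have : (OPT - f S) * (a * l) / k%:R <= f T - f S.
    rewrite ler_pdivrMr // (le_trans _ (ler_wpM2r (ltW k0) H1)) //.
    by move: H2; rewrite /a; lra.
  by lra.
rewrite (_ : a * #|T|%:R / k%:R =
    a * #|S|%:R / k%:R + a * l / k%:R); last first.
  by rewrite /l; field; rewrite gt_eqF.
rewrite opprD expRD mulrA; apply: ler_wpM2r => //; exact: expR_ge0.
Qed.

Lemma on_track_phase tau s S : 0 < tau -> on_track tau S ->
  surely f (phase tau s S) (on_track tau).
Proof.
move=> tau0; elim: s S => // s IH S /(on_track_step tau0) H.
by apply: surely_bind; apply: surely_mono H.
Qed.

(** Either the solution is full, or no element is live and the gap is at most [k * tau]; lowering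
    [tau] by [1 - e] then uses exactly the slack in the last clause of [on_track]. *)
Lemma on_track_next tau S : 0 <= tau -> on_track tau S ->
  potential f k tau S = 0%N -> on_track ((1 - e) * tau) S.
Proof.
have [e0 e1] := (e_gt0, e_le) => tau0 /and3P[Sk fS _].
rewrite /on_track Sk fS /potential; case: leqP => //= Sk' /eqP.
rewrite cards_eq0 => /eqP live0.
have : OPT - f S <= k%:R * tau.
  apply: max_card_le_gain => // x; rewrite leNgt; apply/negP => /ltW xl.
  have : x \in live f tau S by rewrite inE.
  by rewrite live0 inE.
rewrite mulrCA => H; apply: ler_wpM2l => //; lra.
Qed.

(** A union bound over the phases: a phase surely keeps the invariant, and hands it on to the next
    threshold unless it ends with positive potential. *)
Lemma mean_off_track tau J S : 0 < tau -> on_track tau S ->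
  mean f (threshold_greedy tau J S)
    (fun T => (~~ on_track ((1 - e) ^+ J * tau) T)%:R) <= J%:R * phase_failure.
Proof.
elim: J tau S => [|J IH] tau S tau0 tS.
  by rewrite expr0 mul1r [mean _ _ _]/mean /= tS mul0r.
have tau0' := threshold_gt0 tau0.
rewrite mean_bind -natr1 [leRHS]mulrDl mul1r.
apply: (@le_trans _ _ (mean f (phase tau r S)
    (fun T => J%:R * phase_failure + (0 < potential f k tau T)%N%:R))).
  apply: le_mean; apply: surely_mono (on_track_phase r tau0 tS) => T tT.
  have [p0|p_gt0] := posnP (potential f k tau T).
    rewrite addr0 exprSr -mulrA; apply: IH => //.
    exact: on_track_next (ltW tau0) tT p0.
  rewrite -[leLHS]add0r; apply: lerD.
    rewrite mulr_ge0 // /phase_failure; case: ifP => // _.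
    have [e0 e1] := (e_gt0, e_le).
    by rewrite mulr_ge0 // exprn_ge0 //; lra.
  rewrite -[leRHS](mean_cst f (threshold_greedy ((1 - e) * tau) J T)).
  by apply: le_mean; apply: surelyT => T'; rewrite ler_nat; case: on_track.
rewrite meanD mean_cst lerD2l; apply: phase_failure_bound => //.
by case/and3P: tS.
Qed.

(** For a full solution the exponent [(1 - e) ^+ 2] is at least [1 - 2 * e]; otherwise the final
    threshold is so low that the gap is at most [OPT * expR (- 1)]. *)
Lemma on_track_value tau S J : (0 < k)%N -> 0 < OPT -> k%:R * tau <= OPT ->
  (1 - e) ^+ J <= (1 - e) * expR (- 1) -> on_track ((1 - e) ^+ J * tau) S ->
  (1 - 2 * e) * (1 - expR (- 1)) * OPT <= f S.
Proof.
have [e0 e1] := (e_gt0, e_le) => k0 O0 tO eJ /and3P[Sk fS].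
have E0 := expR_gt0 (- 1 : R).
have E1 : expR (- 1) <= 1 :> R by rewrite -[leRHS]expR0 ler_expR; lra.
case: (leqP k #|S|) => [kS _|Sk' /= small].
  have Ek : #|S| = k by apply/eqP; rewrite eqn_leq Sk.
  have conv : expR (- (1 - e) ^+ 2) <= 1 - (1 - 2 * e) * (1 - expR (- 1)) :> R.
    apply: (@le_trans _ _ (expR (- (1 - 2 * e)))).
      rewrite ler_expR lerN2.
      rewrite (_ : (1 - e) ^+ 2 = 1 - 2 * e + e ^+ 2); last by ring.
      by rewrite lerDl sqr_ge0.
    have e2 : 2 * e <= 1 by lra.
    have e20 : 0 <= 2 * e by lra.
    (* The chord of [expR] over the segment from [- 1] to [0] bounds its value at
       [- (1 - 2 * e)]. *)
    have := convex_expR (Itv01 e20 e2) (0 : R) (- 1).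
    rewrite !convRE /= expR0 /unstable.onem mulr0 add0r mulrN1; lra.
  move: fS; rewrite Ek -mulrA divff ?mulr1 ?pnatr_eq0 -?lt0n // => fS.
  have := ler_wpM2l (ltW O0) conv; lra.
have : (1 - e) * (OPT - f S) <= (1 - e) * (expR (- 1) * OPT).
  apply: le_trans small _; rewrite mulrCA mulrA.
  apply: (@le_trans _ _ ((1 - e) ^+ J * OPT)).
    rewrite -mulrA; apply: ler_wpM2l => //.
    by apply: exprn_ge0; lra.
  by rewrite mulrA; apply: ler_wpM2r => //; apply: ltW.
rewrite ler_pM2l; last lra.
have : 0 <= e * (1 - expR (-1)) * OPT.
  by apply: mulr_ge0; [apply: mulr_ge0; lra|apply: ltW].
lra.
Qed.

End ThresholdGreedy.

(** * Parallel guesses *)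

Section ParallelGreedy.
Variables (R : realType) (N : finType) (k : nat) (e : R) (r J G : nat).

(** For a normalized [f] the seed is a set with its true value, so it competes on equal terms. *)
Definition best_of (s : seq ({set N} * R)) : {set N} * R :=
  foldr (fun p q => if q.2 <= p.2 then p else q) (set0, 0) s.

(* The maximum of [f] lies between the largest value [M] of a singleton and
   [#|N| * M]; a geometric grid of guesses for it is tried in parallel. *)
Definition parallel_greedy : oracle_alg R N {set N} :=
  Query [seq [set x] | x <- enum N] (fun ans =>
    let M := \big[Num.max/0]_(y <- ans) y in
    bind (par_map (fun g : nat => threshold_greedy k e r
        (#|N|%:R * M * (1 - e) ^+ g / k%:R) J set0) (iota 0 G))
      (fun Qs => Query Qs (fun vs => Return R N (best_of (zip Qs vs)).1))).

Variable f : {set N} -> R.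
Hypothesis f0 : normalized f.
Hypotheses (f_mono : monotone f) (f_sub : submodular f).
Hypotheses (e_gt0 : 0 < e) (e_le : e <= 2^-1).

Lemma best_ofP (Qs : seq {set N}) (Q := (best_of (zip Qs (map f Qs))).1) :
  Q \in set0 :: Qs /\ forall Q', Q' \in Qs -> f Q' <= f Q.
Proof.
rewrite {}/Q; suff: let p := best_of (zip Qs (map f Qs)) in
    [/\ p.2 = f p.1, p.1 \in set0 :: Qs &
        forall Q', Q' \in Qs -> f Q' <= f p.1].
  by case.
elim: Qs => [|Q Qs [p2 p1 pmax]] /=; first by rewrite f0 mem_head.
case: ifP => [pQ|/negbT]; rewrite ?p2.
  split=> [||Q'] //=; first by rewrite !inE eqxx orbT.
  by rewrite inE => /predU1P[-> //|/pmax /le_trans]; apply; rewrite -p2.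
rewrite -ltNge => /ltW pQ; split=> // [|Q'].
  by move: p1; rewrite !inE => /orP[] ->; rewrite ?orbT.
by rewrite inE => /predU1P[-> //|/pmax].
Qed.

Local Notation M :=
  (\big[Num.max/0]_(y <- map f [seq [set x] | x <- enum N]) y).
Local Notation OPT := (max_card_le f k).

Lemma singleton_max_ge0 : 0 <= M.
Proof. exact: bigmax_ge_id. Qed.

Lemma singleton_max_le : (0 < k)%N -> M <= OPT.
Proof.
move=> k0; rewrite 2!big_map; apply: bigmax_le.
  by rewrite -f0; apply: le_max_card; rewrite cards0.
by move=> x _; apply: le_max_card; rewrite cards1.
Qed.

Lemma max_card_le_singletons : OPT <= #|N|%:R * M.
Proof.
have [T _ ->] := max_card_attained f_mono k.
have := gain_union f_mono f_sub set0 T; rewrite set0U f0 subr0.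
move=> /le_trans; apply; apply: (@le_trans _ _ (\sum_(x in T) M)).
  apply: ler_sum => x _; rewrite /gain f0 subr0 setU0.
  apply: (@le_bigmax_seq _ _ _ _ _ (f [set x]) xpredT id) => //.
  by rewrite -map_comp; apply/mapP; exists x; rewrite ?mem_enum.
rewrite sumr_const -[leLHS]mulr_natl; apply: ler_wpM2r.
  exact: singleton_max_ge0.
by rewrite ler_nat max_card.
Qed.

(** The least exponent whose guess is at most [v] works, because the guess before it exceeds [v]. It
    is below [G] because the guess at [G.-1] is at most [M]. *)
Lemma guess_exists (m M v : R) : 0 < v -> M <= v -> v <= m * M -> (0 < G)%N ->
  0 <= M -> m * (1 - e) ^+ G.-1 <= 1 ->
  exists2 g, (g < G)%N &
    m * M * (1 - e) ^+ g <= v /\ (1 - e) * v <= m * M * (1 - e) ^+ g.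
Proof.
have [e0 e1] := (e_gt0, e_le) => v0 Mv vM G0 M0 small.
have ex : exists g, m * M * (1 - e) ^+ g <= v.
  exists G.-1; apply: le_trans Mv; rewrite mulrAC -[leRHS]mul1r.
  exact: ler_wpM2r.
case: (ex_minnP ex) => g gv gmin; exists g.
  rewrite -(prednK G0) ltnS; apply: gmin; apply: le_trans Mv.
  by rewrite mulrAC -[leRHS]mul1r; apply: ler_wpM2r.
split=> //; case: g gv gmin => [|g] gv gmin.
  by rewrite expr0 mulr1; apply: le_trans vM; rewrite ger_pMl //; lra.
rewrite exprS mulrCA; apply: ler_wpM2l; first lra.
rewrite leNgt; apply/negP => /ltW /gmin.
by rewrite ltnn.
Qed.

Lemma cost_le_parallel_greedy :
  cost_le f parallel_greedy (2 + J * (r * 2))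
    (#|N| + (G * (J * (r * (2 * #|N|.+1))) + G)).
Proof.
split=> //; first by rewrite size_map -cardE leq_addr.
rewrite [X in (_ - X)%N]size_map -cardE addKn.
rewrite (_ : (2 + J * (r * 2)).-1 = J * (r * 2) + 1)%N; last by rewrite addn1.
apply: cost_le_bind.
  rewrite -{2}(size_iota 0 G).
  by apply: cost_le_par_map => g; apply: cost_le_threshold_greedy.
apply: surely_mono (surely_par_map (P := fun=> True) _ _); last first.
  by move=> g; apply: surelyT.
by move=> Qs [sQ _] /=; rewrite sQ size_iota.
Qed.

Lemma surely_guesses : surely f
  (par_map (fun g : nat => threshold_greedy k e r
    (#|N|%:R * M * (1 - e) ^+ g / k%:R) J set0) (iota 0 G))
  (fun Qs => forall Q : {set N}, Q \in Qs -> (#|Q| <= k)%N).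
Proof.
have [e0 e1] := (e_gt0, e_le).
apply: surely_mono (surely_par_map (P := fun Q : {set N} => (#|Q| <= k)%N) _ _).
  by move=> Qs [sQ H] Q /(nthP set0)[i iQ <-]; apply: H; rewrite -sQ.
move=> g; apply: surely_threshold_greedy; rewrite ?cards0 //.
rewrite divr_ge0 // !mulr_ge0 ?singleton_max_ge0 // exprn_ge0 //; lra.
Qed.

Lemma surely_card_parallel_greedy :
  surely f parallel_greedy (fun Q : {set N} => (#|Q| <= k)%N).
Proof.
apply: surely_bind; apply: surely_mono surely_guesses => Qs H.
have [+ _] := best_ofP Qs; rewrite inE => /predU1P[|/H //].
by rewrite [surely _ _ _]/= => ->; rewrite cards0.
Qed.

(** One good guess suffices: its run succeeds with the stated probability, and the returned set is
    worth at least as much as its outcome. *)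
Lemma output_prob_parallel_greedy : (0 < k)%N -> (0 < G)%N -> 0 < OPT ->
  #|N|%:R * (1 - e) ^+ G.-1 <= 1 ->
  (1 - e) ^+ J <= (1 - e) * expR (- 1) ->
  1 - J%:R * phase_failure N e r <=
  output_prob f parallel_greedy (fun Q => (#|Q| <= k)%N &&
    ((1 - 2 * e) * (1 - expR (- 1)) * OPT <= f Q)).
Proof.
move=> k0 G0 O0 Gs Js; set P := (fun Q => _ && _).
have [g gG [gO Og]] := guess_exists O0 (singleton_max_le k0)
  max_card_le_singletons G0 singleton_max_ge0 Gs.
have kR : 0 < k%:R :> R by rewrite ltr0n.
set tau := #|N|%:R * M * (1 - e) ^+ g / k%:R.
have ktau : k%:R * tau = #|N|%:R * M * (1 - e) ^+ g.
  by rewrite /tau mulrCA divff ?mulr1 ?gt_eqF.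
have [e0 e1] := (e_gt0, e_le).
have tau0 : 0 < tau.
  rewrite -(pmulr_rgt0 _ kR) ktau; apply: lt_le_trans Og.
  by rewrite mulr_gt0 //; lra.
apply: (@le_trans _ _ (output_prob f (threshold_greedy k e r tau J set0) P)).
  (* At the empty set the last clause of the invariant is the lower bound [Og] on the guess. *)
  have start : on_track k e f tau set0.
    rewrite /on_track cards0 f0 subr0 ktau Og orbT mulr0 mul0r oppr0 expR0.
    by rewrite mulr1 lexx.
  have := mean_off_track r f_mono f_sub e_gt0 e_le J tau0 start.
  apply: output_prob_ge; apply: surelyT => T.
  case: (boolP (on_track _ _ _ _ T)) => [tT|_] /=; last by rewrite subrr ler0n.
  rewrite subr0 /P (on_track_value e_gt0 e_le k0 O0 _ Js tT) ?ktau //.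
  by case/and3P: tT => ->.
have gi : g \in iota 0 G by rewrite mem_iota.
apply: le_trans (output_prob_par_map f (fun g : nat => threshold_greedy k e r
        (#|N|%:R * M * (1 - e) ^+ g / k%:R) J set0) P gi) _.
rewrite [leRHS]/output_prob -/(mean f _ _) mean_Query mean_bind.
apply: le_mean; apply: surely_mono surely_guesses => Qs H.
rewrite mean_Query /mean /= ler_nat; case: hasP => //= -[Q QQs /andP[Qk OQ]].
have [Qin /(_ _ QQs) QQ] := best_ofP Qs.
rewrite /P (le_trans OQ QQ) andbT lt0b.
by move: Qin; rewrite inE => /predU1P[->|/H //]; rewrite cards0.
Qed.

End ParallelGreedy.

(** * Tuning *)

Section Tuning.
Variable R : realType.
Implicit Types (e x : R) (n c : nat).

Lemma onem_expn_le x m : 0 <= x <= 1 -> (1 - x) ^+ m <= expR (- (m%:R * x)).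
Proof.
move=> /andP[x0 x1]; rewrite -mulrN expRM_natl.
by apply: lerXn2r; rewrite ?nnegrE ?expR_ge0 ?expR_ge1Dx ?subr_ge0.
Qed.

Lemma ln_nat_ge n : (1 < n)%N -> 2^-1 <= ln n%:R :> R.
Proof.
move=> n1; have n0 : 0 < n%:R :> R by rewrite ltr0n ltnW.
rewrite -ler_expR lnK ?posrE //; apply: le_trans (expR_half_le2 R) _.
by rewrite ler_nat.
Qed.

(** The [12] offsets the decay rate [e / 12] of the potential. The exponent [c + 3] leaves [c] after
    one power of [n] is spent on the initial potential and two on the number of phases. *)
Definition phase_length c n e : nat :=
  (Num.truncn (12 * (c + 3)%:R * ln n%:R / e)).+1.

(** One phase beyond those that bring the power of [1 - e] below [expR (- 1)] supplies a further
    factor [1 - e]. *)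
Definition num_phases e : nat := (Num.truncn e^-1).+2.

Definition num_guesses n e : nat := (Num.truncn (ln n%:R / e)).+2.

Lemma phase_length_gt c n e : 0 <= 12 * (c + 3)%:R * ln n%:R / e ->
  12 * (c + 3)%:R * ln n%:R / e < (phase_length c n e)%:R.
Proof. by move=> /truncn_itv /andP[]. Qed.

Lemma num_phases_le e : 0 < e -> (num_phases e)%:R <= e^-1 + 2.
Proof.
move=> e0; have /truncn_itv/andP[H _] : 0 <= e^-1 by rewrite invr_ge0 ltW.
by rewrite /num_phases -!natr1; lra.
Qed.

Lemma num_phases_pow e : 0 < e -> e <= 1 ->
  (1 - e) ^+ num_phases e <= (1 - e) * expR (- 1).
Proof.
move=> e0 e1; rewrite exprS; apply: ler_wpM2l; first lra.
apply: le_trans (onem_expn_le _ _) _; first by rewrite ltW.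
rewrite ler_expR lerN2 -ler_pdivrMr // div1r.
by have /truncn_itv/andP[_ /ltW] : 0 <= e^-1 by rewrite invr_ge0 ltW.
Qed.

Lemma num_guesses_pow n e : (1 < n)%N -> 0 < e -> e <= 1 ->
  n%:R * (1 - e) ^+ (num_guesses n e).-1 <= 1.
Proof.
move=> n1 e0 e1; have n0 : 0 < n%:R :> R by rewrite ltr0n ltnW.
have L := ln_nat_ge n1.
rewrite -ler_pdivlMl // mulr1.
apply: le_trans (onem_expn_le _ _) _; first by rewrite ltW.
rewrite -[X in _ <= X^-1](lnK n0) -expRN ler_expR lerN2 -ler_pdivrMr //.
have /truncn_itv/andP[_ /ltW] // : 0 <= ln n%:R / e.
by rewrite divr_ge0 // ltW //; lra.
Qed.

(** Only phases of at most [n] steps can fail. As the length exceeds a multiple of [1 / e], this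
    case bounds [1 / e] by [n], hence the number of phases by [n ^+ 2], and the failure bound
    becomes independent of [e]. *)
Lemma total_failure_le (N : finType) c e : (1 < #|N|)%N -> 0 < e -> e <= 2^-1 ->
  (num_phases e)%:R * phase_failure N e (phase_length c #|N| e) <=
  (#|N|%:R ^+ c)^-1.
Proof.
move=> n1 e0 e1; rewrite /phase_failure; set n := #|N| in n1 *.
set r := phase_length c n e; have L := ln_nat_ge n1.
have n0 : 0 < n%:R :> R by rewrite ltr0n ltnW.
case: (leqP r n) => rn; last by rewrite mulr0 invr_ge0 exprn_ge0 // ltW.
have Le : 2^-1 / e <= ln n%:R / e by rewrite ler_pM2r ?invr_gt0.
have ei0 : 0 < e^-1 by rewrite invr_gt0.
have c0 : 3 <= (c + 3)%:R :> R by rewrite ler_nat leq_addl.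
have Lc : 3 * (ln n%:R / e) <= (c + 3)%:R * (ln n%:R / e).
  by apply: ler_wpM2r => //; lra.
have r_gt : 12 * (c + 3)%:R * ln n%:R / e < r%:R :> R.
  by apply: phase_length_gt; rewrite -!mulrA; lra.
have rn' : r%:R <= n%:R :> R by rewrite ler_nat.
have n2 : 2 <= n%:R :> R by rewrite ler_nat.
have Jn : (num_phases e)%:R <= n%:R ^+ 2 :> R.
  apply: le_trans (num_phases_le e0) _.
  have : 2 * n%:R <= n%:R ^+ 2 :> R by rewrite expr2 ler_pM2r.
  by lra.
have pw : (1 - e / 12) ^+ r <= (n%:R ^+ (c + 3))^-1.
  apply: le_trans (onem_expn_le _ _) _; first by apply/andP; split; lra.
  rewrite -[X in _ <= (X ^+ _)^-1](lnK n0) -expRM_natl -expRN ler_expR lerN2.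
  move: r_gt; rewrite ltr_pdivrMr //; lra.
apply: (@le_trans _ _ (n%:R ^+ 2 * (n%:R * (n%:R ^+ (c + 3))^-1))).
  apply: ler_pM => //; first by rewrite mulr_ge0 // exprn_ge0 //; lra.
  by apply: ler_wpM2l => //; exact: ltW.
rewrite exprD (_ : _ * _ = (n%:R ^+ c)^-1) //.
by field; rewrite expf_neq0 ?gt_eqF.
Qed.

End Tuning.

(** * Rounds and calls in terms of [n], [ln n] and [1 / e] *)

Section Budgets.
Variables (R : realType) (n c : nat) (e : R).
Hypotheses (n_gt1 : (1 < n)%N) (e_gt0 : 0 < e) (e_le : e <= 2^-1).

Local Notation K := (12 * (c + 3)%:R : R).
Local Notation L := (ln n%:R : R).

Lemma inv_ge2 : 2 <= e^-1.
Proof. by rewrite -[leLHS]invrK lef_pV2 ?posrE ?invr_gt0. Qed.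

Lemma ln_inv_ge1 : 1 <= L * e^-1.
Proof.
rewrite [leLHS](_ : 1 = 2^-1 * 2); last by field.
by apply: ler_pM => //; [exact: ln_nat_ge|exact: inv_ge2].
Qed.

Lemma phase_length_le : (phase_length c n e)%:R <= (K + 1) * (L * e^-1).
Proof.
have La := ln_inv_ge1.
have K0 : 0 <= K by rewrite mulr_ge0.
have /truncn_itv/andP[H _] : 0 <= K * L / e.
  by rewrite -[K * _ / _]mulrA mulr_ge0 //; lra.
by rewrite /phase_length -natr1; move: H La; move: (e^-1) => a; lra.
Qed.

Lemma num_phases_le2 : (num_phases e)%:R <= 2 * e^-1.
Proof. by have := num_phases_le e_gt0; have := inv_ge2; lra. Qed.

Lemma num_guesses_le : (num_guesses n e)%:R <= 3 * (L * e^-1).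
Proof.
have La := ln_inv_ge1.
have /truncn_itv/andP[H _] : 0 <= L / e by lra.
by rewrite /num_guesses -!natr1; lra.
Qed.

Lemma rounds_le (J := num_phases e) (r := phase_length c n e) :
  (2 + J * (r * 2))%:R <= (24 * K + 28) * (L * e^-1 ^+ 2).
Proof.
have a2 := inv_ge2; have La := ln_inv_ge1.
have K0 : 0 <= K by rewrite mulr_ge0.
have H : J%:R * r%:R <= (2 * e^-1) * ((K + 1) * (L * e^-1)).
  by apply: ler_pM => //; [exact: num_phases_le2|exact: phase_length_le].
have La2 : 2 <= L * e^-1 ^+ 2.
  rewrite expr2 mulrA -[leLHS]mul1r; apply: ler_pM => //.
have X : 0 <= K * (L * e^-1 ^+ 2) by rewrite mulr_ge0 //; lra.
rewrite natrD !natrM mulrA; move: H La2 X.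
have -> : 2 * e^-1 * ((K + 1) * (L * e^-1)) = 2 * (K + 1) * (L * e^-1 ^+ 2).
  by ring.
by move: (L * _); move=> y; lra.
Qed.

Lemma calls_le (J := num_phases e) (r := phase_length c n e)
    (G := num_guesses n e) :
  (n + (G * (J * (r * (2 * n.+1))) + G))%:R <=
  (24 * K + 28) * (n%:R * e^-1 ^+ 4 * L ^+ 2).
Proof.
have a2 := inv_ge2; have La := ln_inv_ge1.
have K0 : 0 <= K by rewrite mulr_ge0.
have n2 : 2 <= n%:R :> R by rewrite ler_nat.
have n4 : 2 * (n%:R + 1) <= 4 * n%:R :> R by lra.
have a0 : 0 <= e^-1 by lra.
have H : G%:R * (J%:R * (r%:R * (2 * (n%:R + 1)))) <=
    3 * (L * e^-1) * (2 * e^-1 * ((K + 1) * (L * e^-1) * (4 * n%:R))).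
  apply: ler_pM => //; first exact: num_guesses_le.
  apply: ler_pM => //; first exact: num_phases_le2.
  by apply: ler_pM => //; exact: phase_length_le.
set t := L * e^-1 in La H.
have La2 : 1 <= t ^+ 2 by rewrite exprn_ege1.
have t2 : t <= t ^+ 2 by rewrite expr2 ler_peMl //; lra.
have at2 : 2 * t ^+ 2 <= e^-1 * t ^+ 2 by apply: ler_wpM2r => //; lra.
(* The calls are only of order [n * L ^+ 2 / e ^+ 3]; the remaining factor [e^-1] of the target is
   at least [2] and halves the constant. *)
have aat2 : 2 * (e^-1 * t ^+ 2) <= e^-1 * (e^-1 * t ^+ 2).
  by apply: ler_wpM2r => //; apply: mulr_ge0 => //; lra.
have nt : 1 * (e^-1 * (e^-1 * t ^+ 2)) <= n%:R * (e^-1 * (e^-1 * t ^+ 2)).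
  by apply: ler_wpM2r; [lra|rewrite ler1n ltnW].
set y := e^-1 * (e^-1 * t ^+ 2) in aat2 nt.
have -> : n%:R * e^-1 ^+ 4 * L ^+ 2 = n%:R * y by rewrite /y /t; ring.
have ny : n%:R * 1 <= n%:R * y by apply: ler_wpM2l => //; lra.
have nya : n%:R * (K + 1) * (2 * (e^-1 * t ^+ 2)) <= n%:R * (K + 1) * y.
  by apply: ler_wpM2l => //; rewrite mulr_ge0 //; lra.
have HG : G%:R <= 3 * t := num_guesses_le.
rewrite [leLHS](_ : _ = n%:R +
    (G%:R * (J%:R * (r%:R * (2 * (n%:R + 1)))) + G%:R)); last first.
  by rewrite !natrD !natrM -[n.+1%:R]natr1.
move: H.
have -> : 3 * t * (2 * e^-1 * ((K + 1) * t * (4 * n%:R))) =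
  12 * (n%:R * (K + 1) * (2 * (e^-1 * t ^+ 2))) by ring.
have y0 : 0 <= y by lra.
have nK : 0 <= n%:R * K * y by apply: mulr_ge0 => //; apply: mulr_ge0.
move: nya nK nt ny; rewrite mul1r; move: K => K'; lra.
Qed.

End Budgets.

(** With [e = eps / 2] the loss [2 * e] is [eps]. On at most one element [ln n] is zero, so no query
    fits the budget. *)
Definition tuned_parallel_greedy (R : realType) (c : nat) (N : finType)
    (k : nat) (eps : R) : oracle_alg R N {set N} :=
  if (#|N| <= 1)%N then Return R N set0 else
  parallel_greedy N k (eps / 2) (phase_length c #|N| (eps / 2))
    (num_phases (eps / 2)) (num_guesses #|N| (eps / 2)).

Theorem theorem3p4 (R : realType) :
  exists eps0 : R, 0 < eps0 /\
  forall c : nat,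
  exists (C : R) (p : nat)
         (randomized_parallel_greedy :
            forall N : finType, nat -> R -> oracle_alg R N {set N}),
  forall (N : finType) (k : nat) (eps : R) (f : {set N} -> R),
    0 < eps < eps0 ->
    (forall S, 0 <= f S) -> normalized f -> monotone f -> submodular f ->
    let n := #|N| in
    let alg := randomized_parallel_greedy N k eps in
    [/\ 1 - (n%:R ^+ c)^-1 <=
          output_prob f alg (fun Q => (#|Q| <= k)%N &&
            ((1 - eps) * (1 - expR (- 1)) * max_card_le f k <= f Q)),
        expected_adaptivity f alg <= C * (ln n%:R / eps ^+ 2) &
        expected_oracle_calls f alg <= C * (n%:R / eps ^+ 4 * ln n%:R ^+ p)].
Proof.
exists 1; split=> // c; pose B : R := 24 * (12 * (c + 3)%:R) + 28.
have B0 : 0 <= B by rewrite addr_ge0 // !mulr_ge0.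
(* The [16] is [2 ^+ 4], from [e = eps / 2]. The logarithm is squared: once for the number of
   guesses, once for the phase length. *)
exists (16 * B), 2%N, (fun N => @tuned_parallel_greedy R c N).
move=> N k eps f /andP[eps0 eps1] f_ge0 f0 f_mono f_sub n alg.
have E1 : expR (- 1) <= 1 :> R by rewrite -[leRHS]expR0 ler_expR; lra.
have L0 : 0 <= ln n%:R :> R.
  by case: n => [|m]; [rewrite ln0|rewrite ln_ge0 // ler1n].
have [n1|n1] := leqP n 1.
  rewrite /alg /tuned_parallel_greedy n1.
  rewrite /expected_adaptivity /expected_oracle_calls /output_prob /=.
  split; last by rewrite !mulr_ge0 ?invr_ge0 ?exprn_ge0 // ltW.
    (* For one element the required probability is zero; for none the empty set is the only
       solution. *)
    move: (n1); rewrite leq_eqVlt ltnS leqn0 => /orP[/eqP ->|/eqP nN].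
      by rewrite expr1n invr1 subrr ler0n.
    have -> : max_card_le f k = 0.
      have [T _ ->] := max_card_attained f_mono k.
      suff -> : T = set0 by [].
      by apply/eqP; rewrite -cards_eq0 -leqn0 -nN max_card.
    rewrite cards0 mulr0 f_ge0 /= gerBl invr_ge0 exprn_ge0 //.
  by rewrite !mulr_ge0 ?invr_ge0 ?exprn_ge0 // ltW.
rewrite /alg /tuned_parallel_greedy leqNgt n1 /=; set e := eps / 2.
have e0 : 0 < e by rewrite /e; lra.
have e1 : e <= 2^-1 by rewrite /e; lra.
have ee : 2 * e = eps by rewrite /e; field.
have ei : e^-1 = 2 / eps by rewrite /e; field; rewrite gt_eqF.
have [A1 A2] := expect_cost (cost_le_parallel_greedy k e (phase_length c n e)
  (num_phases e) (num_guesses n e) f).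
split.
- have [O0|O0] := ltP 0 (max_card_le f k).
    have k0 : (0 < k)%N.
      rewrite lt0n; apply: contraTneq O0 => ->.
      have [T + ->] := max_card_attained f_mono 0%N.
      by rewrite leqn0 cards_eq0 => /eqP ->; rewrite f0 ltxx.
    have e1' : e <= 1 by lra.
    have := output_prob_parallel_greedy (phase_length c n e) f0
      f_mono f_sub e0 e1 k0 (ltn0Sn _) O0 (num_guesses_pow n1 e0 e1')
      (num_phases_pow e0 e1').
    rewrite ee; apply: le_trans; rewrite lerD2l lerN2.
    exact: total_failure_le.
  (* If the maximum is not positive, nonnegativity of [f] makes any set of at most [k] elements good
     enough. *)
  apply: (@le_trans _ _ 1); first by rewrite gerBl invr_ge0 exprn_ge0.
  rewrite -[leLHS](mean_cst f (parallel_greedy N k e (phase_length c n e)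
    (num_phases e) (num_guesses n e)) 1).
  apply: le_mean; apply: surely_mono
    (surely_card_parallel_greedy k _ _ _ f0 e0 e1) => Q -> /=.
  rewrite ler1n lt0b; apply: le_trans (f_ge0 Q).
  by rewrite mulr_ge0_le0 // mulr_ge0 //; lra.
- apply: le_trans A1 _; apply: le_trans (rounds_le c n1 e0 e1) _.
  rewrite ei -/B expr_div_n.
  have : 0 <= B * (ln n%:R / eps ^+ 2).
    by rewrite !mulr_ge0 ?invr_ge0 ?exprn_ge0 // ltW.
  by move: (eps ^+ 2)^-1 => a; lra.
- apply: le_trans A2 _; apply: le_trans (calls_le c n1 e0 e1) _.
  by rewrite ei -/B expr_div_n; move: (eps ^+ 4)^-1 => a; lra.
Qed.
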